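(* Let $\mathbb{F}$ be a commutative field of characteristic $0$ and let $f:\mathbb{R}^2 \to \mathbb{F}^2$ preserve unit distance. If $A,B,C,D \in \mathbb{R}^2$, $r \in \mathbb{Q}$ and $\overrightarrow{CD}=r\,\overrightarrow{AB}$, then $\overrightarrow{f(C)f(D)}=r\,\overrightarrow{f(A)f(B)}$.
   Context: For $u=(u_1,u_2)$, $v=(v_1,v_2)\in\mathbb{F}^2$, $\varphi_2(u,v)=(u_1-v_1)^2+(u_2-v_2)^2\in\mathbb{F}$. A map $f:\mathbb{R}^2\to\mathbb{F}^2$ preserves unit distance if for all $x,y\in\mathbb{R}^2$, $|x-y|=1$ (Euclidean distance) implies $\varphi_2(f(x),f(y))=1$. For points $P,Q$ (of $\mathbb{R}^2$ or of $\mathbb{F}^2$), $\overrightarrow{PQ}=Q-P$. Rational numbers are regarded as elements of $\mathbb{F}$ via the canonical embedding $\mathbb{Q}\subseteq\mathbb{F}$. *)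

(* Defs.v *)
From mathcomp Require Import all_boot all_order all_algebra.
From mathcomp Require Import reals.

Set Implicit Arguments.
Unset Strict Implicit.
Unset Printing Implicit Defensive.

Import Order.TTheory GRing.Theory Num.Theory.
Local Open Scope ring_scope.

Definition phi2 (F : fieldType) (u v : 'rV[F]_2) : F :=
  (u 0 0 - v 0 0) ^+ 2 + (u 0 1 - v 0 1) ^+ 2.

(* The library norm on ['rV[R]_2] is the sup norm, not the Euclidean one. *)
Definition euclid_dist (R : realType) (x y : 'rV[R]_2) : R :=
  Num.sqrt ((x 0 0 - y 0 0) ^+ 2 + (x 0 1 - y 0 1) ^+ 2).

Definition preserves_unit_distance (R : realType) (F : fieldType)
    (f : 'rV[R]_2 -> 'rV[F]_2) : Prop :=
  forall x y : 'rV[R]_2, euclid_dist x y = 1 -> phi2 (f x) (f y) = 1.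

Definition vec (K : fieldType) (P Q : 'rV[K]_2) : 'rV[K]_2 := Q - P.

(* Main.v *)
Require Import Defs.
From mathcomp Require Import all_boot all_order all_algebra.
From mathcomp Require Import reals.
From mathcomp Require Import ring lra.

Set Implicit Arguments.
Unset Strict Implicit.
Unset Printing Implicit Defensive.

Import Order.TTheory GRing.Theory Num.Theory.
Local Open Scope ring_scope.

(** The theorem says that, up to a translation, [f] is a Q-linear map.  Since
    an additive map between vector spaces over fields of characteristic 0
    commutes with rational scalars ([additive_ratr]), it is enough to prove
    that [f (x + w) - f x] depends on [w] only ([increment_const]).  As the
    unit vectors generate the plane additively ([unit_vector_ind]), this comes
    down to one statement: [f] maps every rhombus of side 1 to a parallelogram.

    The image of such a rhombus is a closed chain P, M, Q, N of four points of
    F^2 with consecutive squared distances 1.  A short computation, valid even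
    if F^2 contains isotropic vectors, shows that the chain is a parallelogram
    unless P = Q or M = N ([unit_four_cycle]).  So only the injectivity of [f]
    is missing, and it is obtained by bootstrapping from the rhombi made of two
    equilateral triangles.

    For such a rhombus the short diagonal has length 1, hence is not collapsed.
    If the long one were, with squared length 3, one would rotate the rhombus
    about an end of it so that the other end moves by a unit distance (the
    Moser spindle); the rotated long diagonal would then have an image of
    squared length 1, whereas only 0 (collapse) and 3 (parallelogram) are
    possible.  Hence these rhombi go to parallelograms
    ([increment_equilateral]) and [f] is affine on each unit triangular
    lattice.  Such lattices contain vectors of length k and vectors of length
    sqrt (k^2 + 3), so [f] preserves both squared lengths.  These lengths get
    arbitrarily close to each other, so for any two distinct points x, y and k
    large some z lies at distance k from x and sqrt (k^2 + 3) from y; then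
    [f x = f y] would force 3 = 0 in F ([unit_increments_injective]). *)

(** * Squared lengths and similarities of the coordinate plane *)

Definition sqnorm (K : fieldType) (w : 'rV[K]_2) : K :=
  w 0 0 ^+ 2 + w 0 1 ^+ 2.

(** Multiplication by the complex number [c + i s] under the identification
    of the plane with pairs (real part, imaginary part): every vector that has
    to be constructed below is such a multiple of a given one. *)
Definition simil (K : fieldType) (c s : K) (w : 'rV[K]_2) : 'rV[K]_2 :=
  \row_i (if i == 0 then c * w 0 0 - s * w 0 1 else s * w 0 0 + c * w 0 1).

Lemma row2_eq (K : fieldType) (u v : 'rV[K]_2) :
  u 0 0 = v 0 0 -> u 0 1 = v 0 1 -> u = v.
Proof.
move=> e0 e1; apply/rowP => -[[|[|//]] lti].
  by rewrite (_ : Ordinal lti = 0) //; apply: val_inj.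
by rewrite (_ : Ordinal lti = 1) //; apply: val_inj.
Qed.

Ltac row2_ring := apply: row2_eq; rewrite !mxE /=; ring.

Lemma simil0 (K : fieldType) (c s : K) (w : 'rV[K]_2) :
  simil c s w 0 0 = c * w 0 0 - s * w 0 1.
Proof. by rewrite mxE. Qed.

Lemma simil1 (K : fieldType) (c s : K) (w : 'rV[K]_2) :
  simil c s w 0 1 = s * w 0 0 + c * w 0 1.
Proof. by rewrite mxE. Qed.

Lemma simil_id (K : fieldType) (w : 'rV[K]_2) : simil 1 0 w = w.
Proof. by row2_ring. Qed.

Lemma simil_comp (K : fieldType) (c s c' s' : K) (w : 'rV[K]_2) :
  simil c s (simil c' s' w) = simil (c * c' - s * s') (s * c' + c * s') w.
Proof. by row2_ring. Qed.

Lemma similD (K : fieldType) (c s c' s' : K) (w : 'rV[K]_2) :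
  simil c s w + simil c' s' w = simil (c + c') (s + s') w.
Proof. by row2_ring. Qed.

Lemma simil_scale (K : fieldType) (k c s : K) (w : 'rV[K]_2) :
  k *: simil c s w = simil (k * c) (k * s) w.
Proof. by row2_ring. Qed.

Lemma sqnorm_simil (K : fieldType) (c s : K) (w : 'rV[K]_2) :
  sqnorm (simil c s w) = (c ^+ 2 + s ^+ 2) * sqnorm w.
Proof. by rewrite /sqnorm simil0 simil1; ring. Qed.

Lemma sqnormN (K : fieldType) (w : 'rV[K]_2) : sqnorm (- w) = sqnorm w.
Proof. by rewrite /sqnorm !mxE; ring. Qed.

Lemma sqnormB_sym (K : fieldType) (u v : 'rV[K]_2) :
  sqnorm (u - v) = sqnorm (v - u).
Proof. by rewrite -sqnormN opprB. Qed.

Lemma sqnorm0 (K : fieldType) : sqnorm (0 : 'rV[K]_2) = 0.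
Proof. by rewrite /sqnorm !mxE; ring. Qed.

Lemma sqnormZ (K : fieldType) (k : K) (w : 'rV[K]_2) :
  sqnorm (k *: w) = k ^+ 2 * sqnorm w.
Proof. by rewrite /sqnorm !mxE; ring. Qed.

Lemma parallelogram_law (K : fieldType) (u v : 'rV[K]_2) :
  sqnorm (u + v) + sqnorm (u - v) = 2 * (sqnorm u + sqnorm v).
Proof. by rewrite /sqnorm !mxE; ring. Qed.

Lemma sqnorm_lin (K : fieldType) (k l : K) (u v : 'rV[K]_2) :
  sqnorm (k *: u + l *: v) =
    k ^+ 2 * sqnorm u + l ^+ 2 * sqnorm v
    + k * l * (sqnorm u + sqnorm v - sqnorm (u - v)).
Proof. by rewrite /sqnorm !mxE; ring. Qed.

Lemma sqnorm_gt0 (R : realFieldType) (w : 'rV[R]_2) : w != 0 -> 0 < sqnorm w.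
Proof.
move=> w0; rewrite lt_neqAle addr_ge0 ?sqr_ge0 // andbT eq_sym.
apply: contraNneq w0 => /eqP; rewrite paddr_eq0 ?sqr_ge0 // !sqrf_eq0.
by case/andP=> /eqP e0 /eqP e1; apply/eqP/row2_eq; rewrite mxE.
Qed.

Lemma lagrange_identity (K : fieldType) (u v : 'rV[K]_2) :
  (u 0 0 * v 0 0 + u 0 1 * v 0 1) ^+ 2 + (u 0 0 * v 0 1 - u 0 1 * v 0 0) ^+ 2
  = sqnorm u * sqnorm v.
Proof. by rewrite /sqnorm; ring. Qed.

(** A non-isotropic [u] and its quarter turn form an orthogonal basis, so a
    vector with zero dot product and zero determinant against [u] vanishes. *)
Lemma frame_eq0 (K : fieldType) (u v : 'rV[K]_2) :
    sqnorm u != 0 -> u 0 0 * v 0 0 + u 0 1 * v 0 1 = 0 ->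
  u 0 0 * v 0 1 - u 0 1 * v 0 0 = 0 -> v = 0.
Proof.
move=> u0 dot0 det0; apply: row2_eq; apply: (mulfI u0);
  rewrite [X in _ = _ * X]mxE /sqnorm mulr0.
  transitivity (u 0 0 * (u 0 0 * v 0 0 + u 0 1 * v 0 1)
                - u 0 1 * (u 0 0 * v 0 1 - u 0 1 * v 0 0)); first by ring.
  by rewrite dot0 det0; ring.
transitivity (u 0 1 * (u 0 0 * v 0 0 + u 0 1 * v 0 1)
              + u 0 0 * (u 0 0 * v 0 1 - u 0 1 * v 0 0)); first by ring.
by rewrite dot0 det0; ring.
Qed.

(** * Closed chains of four unit segments *)

(** With p = Q - P, m = M - P, n = N - P, both p and s = p - (m + n) are
    orthogonal to the nonzero vector m - n, so they are parallel; moreover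
    p . s = 0, because p . m and p . n both equal half of p . p.  This gives
    s = 0 as soon as p is not isotropic.  An isotropic p would be orthogonal
    to m, hence also parallel to m by the Lagrange identity, hence zero since
    m has length 1. *)
Lemma unit_four_cycle (K : fieldType) (P M Q N : 'rV[K]_2) :
    (2 : K) != 0 ->
    sqnorm (M - P) = 1 -> sqnorm (Q - M) = 1 ->
    sqnorm (N - P) = 1 -> sqnorm (Q - N) = 1 ->
  [\/ P = Q, M = N | P + Q = M + N].
Proof.
move=> two0 hMP hQM hNP hQN.
have [->|neqPQ] := eqVneq P Q; first by constructor 1.
have [->|neqMN] := eqVneq M N; first by constructor 2.
constructor 3.
set p := Q - P; set m := M - P; set n := N - P.
have hm : sqnorm m = 1 by [].
have hn : sqnorm n = 1 by [].
have hpm : sqnorm (p - m) = 1 by rewrite /p /m opprB addrA subrK.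
have hpn : sqnorm (p - n) = 1 by rewrite /p /n opprB addrA subrK.
have p0 : p != 0 by rewrite subr_eq0 eq_sym.
have mn0 : m != n by rewrite /m /n (inj_eq (addIr _)).
suff : p - (m + n) = 0.
  move/eqP; rewrite subr_eq0 => /eqP e.
  have -> : Q = p + P by rewrite subrK.
  by rewrite e /m /n; row2_ring.
clearbody p m n; clear -two0 hm hn hpm hpn p0 mn0.
have dotpm : 2 * (p 0 0 * m 0 0 + p 0 1 * m 0 1) = sqnorm p.
  transitivity (sqnorm p + sqnorm m - sqnorm (p - m)).
    by rewrite /sqnorm !mxE; ring.
  by rewrite hm hpm; ring.
have dotpn : 2 * (p 0 0 * n 0 0 + p 0 1 * n 0 1) = sqnorm p.
  transitivity (sqnorm p + sqnorm n - sqnorm (p - n)).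
    by rewrite /sqnorm !mxE; ring.
  by rewrite hn hpn; ring.
have qp0 : sqnorm p != 0.
  apply: contraNneq p0 => qp.
  have dot0 : m 0 0 * p 0 0 + m 0 1 * p 0 1 = 0.
    by apply: (mulfI two0); rewrite mulr0 -qp -dotpm; ring.
  apply/eqP/(@frame_eq0 _ m); rewrite ?hm ?oner_eq0 //.
  have := lagrange_identity m p; rewrite dot0 qp mulr0 expr0n add0r.
  by move/eqP; rewrite sqrf_eq0 => /eqP.
have dots : p 0 0 * (p - (m + n)) 0 0 + p 0 1 * (p - (m + n)) 0 1 = 0.
  apply: (mulfI two0); rewrite mulr0 !mxE.
  transitivity (2 * sqnorm p - 2 * (p 0 0 * m 0 0 + p 0 1 * m 0 1)
                - 2 * (p 0 0 * n 0 0 + p 0 1 * n 0 1)).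
    by rewrite /sqnorm; ring.
  by rewrite dotpm dotpn; ring.
apply: (frame_eq0 qp0 dots).
have dp : (m 0 0 - n 0 0) * p 0 0 + (m 0 1 - n 0 1) * p 0 1 = 0.
  apply: (mulfI two0); rewrite mulr0.
  transitivity (2 * (p 0 0 * m 0 0 + p 0 1 * m 0 1)
                - 2 * (p 0 0 * n 0 0 + p 0 1 * n 0 1)); first by ring.
  by rewrite dotpm dotpn subrr.
have ds : (m 0 0 - n 0 0) * (p - (m + n)) 0 0
          + (m 0 1 - n 0 1) * (p - (m + n)) 0 1 = 0.
  transitivity (((m 0 0 - n 0 0) * p 0 0 + (m 0 1 - n 0 1) * p 0 1)
                - (sqnorm m - sqnorm n)).
    by rewrite /sqnorm !mxE; ring.
  by rewrite dp hm hn; ring.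
set s := p - (m + n) in ds *; clearbody s.
(* Cramer: both [p] and [s] being orthogonal to [m - n], the determinant of
   [p] and [s] annihilates both coordinates of [m - n]. *)
apply/eqP; apply: contraNT mn0 => det0; apply/eqP/row2_eq; apply/eqP;
  rewrite -subr_eq0 -(mulIr_eq0 _ (mulIf det0)); apply/eqP.
  transitivity (s 0 1 * ((m 0 0 - n 0 0) * p 0 0 + (m 0 1 - n 0 1) * p 0 1)
    - p 0 1 * ((m 0 0 - n 0 0) * s 0 0 + (m 0 1 - n 0 1) * s 0 1));
    first by ring.
  by rewrite dp ds; ring.
transitivity (p 0 0 * ((m 0 0 - n 0 0) * s 0 0 + (m 0 1 - n 0 1) * s 0 1)
  - s 0 0 * ((m 0 0 - n 0 0) * p 0 0 + (m 0 1 - n 0 1) * p 0 1));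
  first by ring.
by rewrite dp ds; ring.
Qed.

(** * Equilateral rhombi *)

Definition increment (K L : fieldType) (f : 'rV[K]_2 -> 'rV[L]_2)
    (a x : 'rV[K]_2) : 'rV[L]_2 :=
  f (x + a) - f x.

(** Preservation of unit distance, freed from square roots so that it makes
    sense over any field. *)
Definition unit_increments (K L : fieldType) (f : 'rV[K]_2 -> 'rV[L]_2) : Prop :=
  forall a x, sqnorm a = 1 -> sqnorm (increment f a x) = 1.

Lemma preserves_unit_increments (R : realType) (F : fieldType)
    (f : 'rV[R]_2 -> 'rV[F]_2) :
  preserves_unit_distance f -> unit_increments f.
Proof.
move=> hf a x qa; have := hf (x + a) x.
rewrite /euclid_dist /phi2 /increment /sqnorm !mxE; apply.
have -> : (x 0 0 + a 0 0 - x 0 0) ^+ 2 + (x 0 1 + a 0 1 - x 0 1) ^+ 2 = sqnorm a.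
  by rewrite /sqnorm; ring.
by rewrite qa sqrtr1.
Qed.

Definition unit_equilateral (K : fieldType) (a b : 'rV[K]_2) : Prop :=
  [/\ sqnorm a = 1, sqnorm b = 1 & sqnorm (a - b) = 1].

Lemma equilateral_C (K : fieldType) (a b : 'rV[K]_2) :
  unit_equilateral a b -> unit_equilateral b a.
Proof. by case=> qa qb qab; split; rewrite // sqnormB_sym. Qed.

(** The third side of the triangle, as a vector making an angle of 60 degrees
    with [a] on the other side. *)
Lemma equilateral_B (K : fieldType) (a b : 'rV[K]_2) :
  unit_equilateral a b -> unit_equilateral a (a - b).
Proof. by case=> qa qb qab; split; rewrite // opprB addrC subrK. Qed.

Lemma equilateral_simil (K : fieldType) (c s : K) (a b : 'rV[K]_2) :
    c ^+ 2 + s ^+ 2 = 1 -> unit_equilateral a b ->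
  unit_equilateral (simil c s a) (simil c s b).
Proof.
move=> cs [qa qb qab]; split; rewrite ?sqnorm_simil ?cs ?mul1r //.
rewrite (_ : _ - _ = simil c s (a - b)) ?sqnorm_simil ?cs ?mul1r //.
by row2_ring.
Qed.

Lemma equilateral_increments (K L : fieldType) (f : 'rV[K]_2 -> 'rV[L]_2)
    (a b x : 'rV[K]_2) :
    unit_increments f -> unit_equilateral a b ->
  unit_equilateral (increment f a x) (increment f b x).
Proof.
move=> hf [qa qb qab]; split; [exact: hf | exact: hf |].
have <- : increment f (a - b) (x + b) = increment f a x - increment f b x.
  rewrite /increment (_ : x + b + (a - b) = x + a); last by row2_ring.
  by row2_ring.
exact: hf.
Qed.

Lemma equilateral_rot60 (R : rcfType) (a : 'rV[R]_2) :
  sqnorm a = 1 -> unit_equilateral a (simil (1 / 2) (Num.sqrt 3 / 2) a).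
Proof.
move=> qa.
have s3 : Num.sqrt 3 ^+ 2 = 3 :> R by rewrite sqr_sqrtr.
split=> //.
  by rewrite sqnorm_simil qa mulr1 !expr_div_n s3; field.
set s := Num.sqrt 3 in s3 *.
have -> : a - simil (1 / 2) (s / 2) a = simil (1 / 2) (- (s / 2)) a.
  by apply: row2_eq; rewrite !mxE /=; field.
by rewrite sqnorm_simil qa mulr1 sqrrN !expr_div_n s3; field.
Qed.

Lemma equilateral_rhombus_cases (K L : fieldType) (f : 'rV[K]_2 -> 'rV[L]_2)
    (a b x : 'rV[K]_2) :
    (2 : L) != 0 -> unit_increments f -> unit_equilateral a b ->
  f x = f (x + (a + b)) \/ f x + f (x + (a + b)) = f (x + a) + f (x + b).
Proof.
move=> two0 hf [qa qb qab].
have := @unit_four_cycle _ (f x) (f (x + a)) (f (x + (a + b))) (f (x + b)) two0.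
case.
- exact: (hf a x).
- by rewrite addrA; apply: (hf b (x + a)).
- exact: (hf b x).
- by rewrite (addrC a) addrA; apply: (hf a (x + b)).
- by left.
- move=> e; have := hf (a - b) (x + b) qab.
  have e' : x + b + (a - b) = x + a by row2_ring.
  rewrite /increment e' e subrr sqnorm0 => /eqP.
  by rewrite eq_sym oner_eq0.
- by right.
Qed.

(** The vertices x, x + a, x + a + b, x + b span an equilateral rhombus with
    short diagonal a - b; equality of the two increments of [f] says that its
    image is a parallelogram.  A collapse of the long diagonal is refuted by
    the Moser spindle: a second copy of the rhombus, rotated about x, whose
    far vertex is at distance 1 from x + a + b. *)
Lemma increment_equilateral (R : rcfType) (F : fieldType) (f : 'rV[R]_2 -> 'rV[F]_2)
    (a b x : 'rV[R]_2) :
    (2 : F) != 0 -> unit_increments f -> unit_equilateral a b ->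
  increment f a (x + b) = increment f a x.
Proof.
move=> two0 hf hab; have [qa qb qab] := hab.
suff e : f x + f (x + (a + b)) = f (x + a) + f (x + b).
  have e' : f (x + (a + b)) = f (x + a) + f (x + b) - f x.
    by rewrite -e [f x + _]addrC addrK.
  by rewrite /increment -addrA (addrC b) e'; row2_ring.
case: (equilateral_rhombus_cases x two0 hf hab) => // collapse.
(* A rotation of cosine 5/6 moves a vector of squared length 3 by
   3 (2 - 2 * 5/6) = 1. *)
pose s := Num.sqrt (11 : R) / 6.
have cs : (5 / 6) ^+ 2 + s ^+ 2 = 1.
  by rewrite /s !expr_div_n sqr_sqrtr //; field.
have hab' := equilateral_simil cs hab.
have [qa' qb' qab'] := hab'.
set a' := simil _ _ a in hab' qa' qab' *; set b' := simil _ _ b in hab' qb' qab' *.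
have short : sqnorm ((a' + b') - (a + b)) = 1.
  have -> : (a' + b') - (a + b) = simil (- (1 / 6)) s (a + b).
    by rewrite /a' /b'; apply: row2_eq; rewrite !mxE /=; field.
  have -> : sqnorm (simil (- (1 / 6)) s (a + b)) = ((1 / 6) ^+ 2 + s ^+ 2) * 3.
    rewrite sqnorm_simil sqrrN; congr (_ * _); apply: (addIr 1).
    by rewrite -{1}qab parallelogram_law qa qb; ring.
  rewrite (canRL (addKr _) cs).
  by field.
have := hf _ (x + (a + b)) short; rewrite /increment -collapse.
have -> : x + (a + b) + (a' + b' - (a + b)) = x + (a' + b') by row2_ring.
have [<-|e'] := equilateral_rhombus_cases x two0 hf hab'.
  by rewrite subrr sqnorm0 => /eqP; rewrite eq_sym oner_eq0.
(* Otherwise the long diagonal of the image has squared length 4 - 1 = 3,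
   while the collapse of the first rhombus makes it 1. *)
have := parallelogram_law (increment f a' x) (increment f b' x).
have -> : increment f a' x + increment f b' x = f (x + (a' + b')) - f x.
  have -> : f (x + (a' + b')) = f (x + a') + f (x + b') - f x.
    by rewrite -e' [f x + _]addrC addrK.
  by rewrite /increment; row2_ring.
have [-> -> ->] := equilateral_increments x hf hab'.
move=> + h; rewrite h => /eqP.
rewrite -subr_eq0 (_ : _ - _ = - 2); last by ring.
by rewrite oppr_eq0 (negbTE two0).
Qed.

(** * Distances preserved along triangular lattices, and injectivity *)

(** A step along [a] is the sum of the two steps [b] and [a - b], each of which
    forms with [a] an equilateral rhombus. *)
Lemma increment_unit_line (R : rcfType) (F : fieldType)
    (f : 'rV[R]_2 -> 'rV[F]_2) (a x : 'rV[R]_2) (n : nat) :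
    (2 : F) != 0 -> unit_increments f -> sqnorm a = 1 ->
  increment f a (x + n%:R *: a) = increment f a x.
Proof.
move=> two0 hf qa; have hab := equilateral_rot60 qa.
elim: n => [|n IHn]; first by rewrite scale0r addr0.
rewrite -{}IHn.
set b := simil _ _ a in hab.
have -> : x + n.+1%:R *: a = x + n%:R *: a + (a - b) + b.
  by rewrite -natr1; row2_ring.
rewrite (increment_equilateral _ two0 hf hab).
by rewrite (increment_equilateral _ two0 hf (equilateral_B hab)).
Qed.

Lemma unit_line_affine (R : rcfType) (F : fieldType)
    (f : 'rV[R]_2 -> 'rV[F]_2) (a x : 'rV[R]_2) (n : nat) :
    (2 : F) != 0 -> unit_increments f -> sqnorm a = 1 ->
  f (x + n%:R *: a) = f x + n%:R *: increment f a x.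
Proof.
move=> two0 hf qa; elim: n => [|n IHn]; first by rewrite !scale0r !addr0.
have -> : x + n.+1%:R *: a = x + n%:R *: a + a.
  by rewrite -natr1; row2_ring.
have := increment_unit_line x n two0 hf qa; rewrite {1}/increment.
move/eqP; rewrite subr_eq => /eqP ->; rewrite IHn -natr1.
by row2_ring.
Qed.

Lemma preserves_nat_distance (R : rcfType) (F : fieldType)
    (f : 'rV[R]_2 -> 'rV[F]_2) (w x : 'rV[R]_2) (k : nat) :
    (2 : F) != 0 -> unit_increments f -> sqnorm w = k.+1%:R ^+ 2 ->
  sqnorm (increment f w x) = k.+1%:R ^+ 2.
Proof.
move=> two0 hf qw; have k0 : k.+1%:R != 0 :> R by rewrite pnatr_eq0.
pose a := k.+1%:R^-1 *: w.
have qa : sqnorm a = 1.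
  by rewrite sqnormZ qw -exprMn mulVf // expr1n.
have -> : w = k.+1%:R *: a by rewrite scalerA mulfV // scale1r.
by rewrite /increment unit_line_affine // addrC addKr sqnormZ hf // mulr1.
Qed.

(** In the lattice spanned by unit vectors a, b at 60 degrees, k a + 2 b has
    component k + 1 along a and sqrt 3 across it, hence squared length
    (k + 1)^2 + 3.  Conversely each vector of that length is of this form, and
    [f] acts on the lattice as an affine map onto a lattice with the same Gram
    matrix. *)
Lemma preserves_sqrt_sqr_add3 (R : rcfType) (F : fieldType)
    (f : 'rV[R]_2 -> 'rV[F]_2) (w x : 'rV[R]_2) (k : nat) :
    (2 : F) != 0 -> unit_increments f -> sqnorm w = k.+1%:R ^+ 2 + 3 ->
  sqnorm (increment f w x) = k.+1%:R ^+ 2 + 3.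
Proof.
move=> two0 hf qw.
set N : R := k.+1%:R ^+ 2 + 3 in qw.
have N0 : N != 0 by rewrite gt_eqF // ltr_wpDl // sqr_ge0.
have s3 : Num.sqrt 3 ^+ 2 = 3 :> R by rewrite sqr_sqrtr.
(* Solve w = (k + 1 + i sqrt 3) a for the unit vector a. *)
pose a := simil (k.+1%:R / N) (- (Num.sqrt 3 / N)) w.
have qa : sqnorm a = 1.
  rewrite sqnorm_simil qw sqrrN !expr_div_n s3 -mulrDl -/N.
  by rewrite expr2 invfM mulrA mulfV // mul1r mulVf.
have hab := equilateral_rot60 qa; set b := simil _ _ a in hab.
have wE : w = k%:R *: a + 2%:R *: b.
  rewrite /b /a simil_comp !simil_scale similD -[LHS]simil_id -natr1.
  congr simil.
    transitivity ((k.+1%:R ^+ 2 + Num.sqrt 3 ^+ 2) / N).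
      by rewrite s3 mulfV.
    by rewrite -natr1; field.
  by field.
have [qA qB qAB] := equilateral_increments x hf hab.
have -> : increment f w x = k%:R *: increment f a x + 2%:R *: increment f b x.
  have qb : sqnorm b = 1 by case: hab.
  rewrite wE {1}/increment addrA unit_line_affine // unit_line_affine //.
  have -> : increment f b (x + k%:R *: a) = increment f b x.
    elim: (k) => [|n IHn]; first by rewrite scale0r addr0.
    rewrite -natr1 scalerDl scale1r addrA.
    by rewrite (increment_equilateral _ two0 hf (equilateral_C hab)).
  by row2_ring.
rewrite sqnorm_lin qA qB qAB -natr1; ring.
Qed.

(** If [f x = f y] with x, y distinct, consider z = x + w at distance k + 1
    from x and sqrt ((k + 1)^2 + 3) from y, which exists for k large: both
    distances are preserved, so the squared distance from [f z] to the common
    image is both (k + 1)^2 and (k + 1)^2 + 3. *)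
Lemma unit_increments_injective (R : realType) (F : fieldType)
    (f : 'rV[R]_2 -> 'rV[F]_2) :
    (2 : F) != 0 -> (3 : F) != 0 -> unit_increments f -> injective f.
Proof.
move=> two0 three0 hf x y fxy; apply/eqP; rewrite eq_sym -subr_eq0.
apply/negPn/negP => p0; set p := y - x in p0.
have D0 := sqnorm_gt0 p0; set D := sqnorm p in D0.
(* The value of [c] is forced by |w - p|^2 - |w|^2 = D - 2 c D = 3; the
   component of [w] across [p] then adjusts |w| and is real for [k] large. *)
pose c := (D - 3) / (2 * D).
have [k hk] : exists k : nat, D * c ^+ 2 <= k.+1%:R ^+ 2.
  exists (Num.truncn (D * c ^+ 2)); apply: le_trans (ltW (truncnS_gt _)) _.
  by rewrite expr2 ler_peMr ?ler0n ?ler1n.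
pose s := Num.sqrt (k.+1%:R ^+ 2 / D - c ^+ 2).
have hs : s ^+ 2 = k.+1%:R ^+ 2 / D - c ^+ 2.
  by rewrite sqr_sqrtr // subr_ge0 ler_pdivlMr // mulrC.
have D0' : D != 0 by rewrite gt_eqF.
pose w := simil c s p.
have qw : sqnorm w = k.+1%:R ^+ 2.
  by rewrite sqnorm_simil hs -/D addrC subrK divfK.
have qwp : sqnorm (w - p) = k.+1%:R ^+ 2 + 3.
  have -> : w - p = simil (c - 1) s p by rewrite /w; row2_ring.
  rewrite sqnorm_simil hs -/D /c; field.
  by rewrite D0'.
have := preserves_sqrt_sqr_add3 y two0 hf qwp.
have -> : increment f (w - p) y = increment f w x.
  by rewrite /increment -fxy; congr (f _ - _); rewrite /p; row2_ring.
rewrite (preserves_nat_distance x two0 hf qw) => /eqP.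
by rewrite -subr_eq0 opprD addNKr oppr_eq0 (negbTE three0).
Qed.

(** * Additivity *)

(** Injectivity excludes both degenerate cases of [unit_four_cycle] unless the
    rhombus itself is flat, and flat rhombi lie on a line of unit steps. *)
Lemma increment_unit_rhombus (R : realType) (F : fieldType) (f : 'rV[R]_2 -> 'rV[F]_2)
    (a b x : 'rV[R]_2) :
    (2 : F) != 0 -> (3 : F) != 0 -> unit_increments f ->
    sqnorm a = 1 -> sqnorm b = 1 ->
  increment f a (x + b) = increment f a x.
Proof.
move=> two0 three0 hf qa qb.
have inj := unit_increments_injective two0 three0 hf.
have [->|neqab] := eqVneq b a.
  by have := increment_unit_line x 1 two0 hf qa; rewrite scale1r.
have [->|neqaNb] := eqVneq b (- a).
  have := increment_unit_line (x - a) 1 two0 hf qa.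
  by rewrite scale1r subrK => ->.
have := @unit_four_cycle _ (f x) (f (x + a)) (f (x + (a + b))) (f (x + b)) two0.
case.
- exact: (hf a x).
- by rewrite addrA; apply: (hf b (x + a)).
- exact: (hf b x).
- by rewrite (addrC a) addrA; apply: (hf a (x + b)).
- move/inj/eqP; rewrite -subr_eq0 opprD addrA subrr sub0r oppr_eq0.
  by rewrite addrC addr_eq0 (negbTE neqaNb).
- by move/inj/addrI/eqP; rewrite eq_sym (negbTE neqab).
have -> : x + (a + b) = x + b + a by rewrite (addrC a) addrA.
rewrite addrC => /eqP; rewrite -subr_eq -addrA => /eqP.
by rewrite /increment => e; apply/eqP; rewrite subr_eq -e; apply/eqP; row2_ring.
Qed.

(** The unit vectors generate the plane additively: a vector of length at most
    2 is the sum of two unit vectors, symmetric about it, and any vector is an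
    integer multiple of such a short one. *)
Lemma unit_vector_ind (R : realType) (P : 'rV[R]_2 -> Prop) :
    (forall a, sqnorm a = 1 -> P a) ->
    (forall u v, P u -> P v -> P (u + v)) ->
  forall w, P w.
Proof.
move=> P1 PD.
have P0 : P 0.
  pose e : 'rV[R]_2 := \row_i (i == 0)%:R.
  have qe : sqnorm e = 1 by rewrite /sqnorm !mxE /=; ring.
  by rewrite -(subrr e); apply: PD; apply: P1; rewrite ?sqnormN.
have Pn u n : P u -> P (n%:R *: u).
  move=> Pu; elim: n => [|n IHn]; first by rewrite scale0r.
  by rewrite -natr1 scalerDl scale1r; apply: PD.
have Pshort u : sqnorm u <= 4 -> P u.
  move=> qu; have [->//|u0] := eqVneq u 0.
  have D0 := sqnorm_gt0 u0.
  pose s := Num.sqrt ((1 - sqnorm u / 4) / sqnorm u).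
  have hs : s ^+ 2 = (1 - sqnorm u / 4) / sqnorm u.
    by rewrite sqr_sqrtr // divr_ge0 ?(ltW D0) // subr_ge0 ler_pdivrMr // mul1r.
  have D0' : sqnorm u != 0 by rewrite gt_eqF.
  have -> : u = simil (1 / 2) s u + simil (1 / 2) (- s) u.
    by apply: row2_eq; rewrite !mxE /=; field.
  by apply: PD; apply: P1; rewrite sqnorm_simil ?sqrrN hs; field.
move=> w; pose n := (Num.truncn (sqnorm w)).+1.
have n0 : n%:R != 0 :> R by rewrite pnatr_eq0.
have -> : w = n%:R *: (n%:R^-1 *: w) by rewrite scalerA mulfV // scale1r.
apply/Pn/Pshort; rewrite sqnormZ exprVn mulrC ler_pdivrMr ?exprn_gt0 ?ltr0n //.
have : sqnorm w <= n%:R by apply/ltW/truncnS_gt.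
have : 1 <= n%:R :> R by rewrite ler1n.
by nra.
Qed.

(** Two inductions on unit vectors: the base point may be translated first by
    unit vectors, hence by all vectors; then the increment along a sum of unit
    vectors splits into unit increments. *)
Lemma increment_const (R : realType) (F : fieldType)
    (f : 'rV[R]_2 -> 'rV[F]_2) :
    (2 : F) != 0 -> (3 : F) != 0 -> unit_increments f ->
  forall w x y, increment f w x = increment f w y.
Proof.
move=> two0 three0 hf.
have unit_inv w : forall a x, sqnorm a = 1 ->
    increment f a (x + w) = increment f a x.
  elim/unit_vector_ind: w => [b qb a x qa|u v IHu IHv a x qa].
    exact: increment_unit_rhombus.
  by rewrite addrA IHv // IHu.
elim/unit_vector_ind => [a qa x y|u v IHu IHv x y].
  by rewrite -(unit_inv (x - y) a y qa) (addrC y) subrK.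
have split z : increment f (u + v) z = increment f u z + increment f v (z + u).
  by rewrite /increment addrA; row2_ring.
by rewrite !split (IHu x y) (IHv (x + u) (y + u)).
Qed.

Lemma additive_ratr (R : numFieldType) (F : fieldType)
    (V : lmodType R) (W : lmodType F) (L : V -> W) :
    [pchar F] =i pred0 -> (forall u v, L (u + v) = L u + L v) ->
  forall (r : rat) w, L (ratr r *: w) = ratr r *: L w.
Proof.
move=> charF0 LD r w.
have L0 : L 0 = 0 by apply: (addrI (L 0)); rewrite -LD !addr0.
have LN u : L (- u) = - L u.
  by apply/eqP; rewrite -addr_eq0 -LD addNr L0.
have Ln (n : nat) u : L (n%:R *: u) = n%:R *: L u.
  elim: n => [|n IHn]; first by rewrite !scale0r.
  by rewrite -!natr1 !scalerDl !scale1r LD IHn.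
have Lz (m : int) u : L (m%:~R *: u) = m%:~R *: L u.
  case: m => n; first exact: Ln.
  by rewrite NegzE !rmorphN /= !scaleNr LN Ln.
have intF0 (m : int) : m != 0 -> m%:~R != 0 :> F.
  move=> m0; rewrite -absz_eq0 in m0.
  have : (`|m|%N)%:R != 0 :> F by rewrite ((pcharf0P F).1 charF0).
  by case: (intP m) => // n; rewrite ?abszN // rmorphN oppr_eq0.
have dF : (denq r)%:~R != 0 :> F by apply: intF0; rewrite denq_neq0.
have dR : (denq r)%:~R != 0 :> R by rewrite intr_eq0 denq_neq0.
apply: (scalerI dF); rewrite -Lz !scalerA /ratr.
by rewrite mulrCA divff // mulr1 mulrCA divff // mulr1 Lz.
Qed.

Theorem theorem7 (R : realType) (F : fieldType) (charF0 : [pchar F] =i pred0)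
    (f : 'rV[R]_2 -> 'rV[F]_2) (hf : preserves_unit_distance f)
    (A B C D : 'rV[R]_2) (r : rat) (hCD : vec C D = ratr r *: vec A B) :
  vec (f C) (f D) = ratr r *: vec (f A) (f B).
Proof.
have nF0 n : n.+1%:R != 0 :> F by rewrite ((pcharf0P F).1 charF0).
have incE := increment_const (nF0 1%N) (nF0 2%N) (preserves_unit_increments hf).
pose L w := increment f w 0.
have LD u v : L (u + v) = L u + L v.
  by rewrite /L [increment f v 0](incE v 0 (0 + u)) /increment addrA; row2_ring.
have vecE P Q : vec (f P) (f Q) = L (vec P Q).
  by rewrite /L /vec (incE _ 0 P) /increment (addrC P) subrK.
by rewrite !vecE hCD (additive_ratr charF0 LD).
Qed.
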